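(* Let $A\in\mathbb{R}^{n\times n}$, $B\in\mathbb{R}^{n\times m}$, $F\in\mathbb{R}^{r\times n}$, and $R\in\mathbb{R}^{(n_0-r)\times n}$ with $r<n_0\le n$, such that $\begin{pmatrix} F \\ R \end{pmatrix}\in\mathbb{R}^{n_0\times n}$ has full row rank $n_0$. Consider the system $\dot{x}(t)=Ax(t)+Bu(t)$. A control law of the form $u(t)=-Z\begin{pmatrix} F \\ R \end{pmatrix}x(t)$, $Z\in\mathbb{R}^{m\times n_0}$, can drive the linearly independent functions $\begin{pmatrix} F \\ R \end{pmatrix}x(t)\to\mathbf 0$ as $t\to\infty$ at an arbitrary rate of convergence from any initial condition $\begin{pmatrix} F \\ R \end{pmatrix}x(t_0)$ by placing $n_0$ poles of a subsystem of order $n_0$ (in the sense made precise in the context) if and only if both of the following conditions hold: $$\operatorname{rank}\begin{pmatrix} FA \\ RA \\ F \\ R \end{pmatrix}=\operatorname{rank}\begin{pmatrix} F \\ R \end{pmatrix},$$ $$\operatorname{rank}\begin{pmatrix} sF-FA & FB \\ sR-RA & RB \end{pmatrix}=\operatorname{rank}\begin{pmatrix} F \\ R \end{pmatrix}\quad\text{for all } s\in\mathbb{C}.$$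
   Context: Write $G=\begin{pmatrix} F \\ R \end{pmatrix}$. ''The control law $u=-ZGx$ can drive $Gx(t)\to\mathbf 0$ at an arbitrary rate of convergence from any initial condition by placing $n_0$ poles of a subsystem of order $n_0$'' means: for every multiset $\Lambda=\{\lambda_1,\dots,\lambda_{n_0}\}$ of $n_0$ complex numbers with negative real parts that is closed under complex conjugation, there exist $Z\in\mathbb{R}^{m\times n_0}$ and $M\in\mathbb{R}^{n_0\times n_0}$ such that every solution of the closed-loop system $\dot{x}=(A-BZG)x$ satisfies $\frac{d}{dt}(Gx(t))=M\,Gx(t)$ (equivalently $G(A-BZG)=MG$), and the eigenvalues of $M$, counted with algebraic multiplicity, are exactly $\Lambda$ (so $Gx(t)\to\mathbf 0$ for every initial condition, at a rate prescribed by $\Lambda$). *)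

(* Defs.v *)
From HB Require Import structures.
From mathcomp Require Import all_boot all_order all_algebra.
From mathcomp Require Import all_classical all_reals all_analysis.
From mathcomp Require Import complex.

Set Implicit Arguments.
Unset Strict Implicit.
Unset Printing Implicit Defensive.

Import Order.TTheory GRing.Theory Num.Theory.
Import numFieldNormedType.Exports.

Local Open Scope ring_scope.

Definition complex_mx (K : realType) (p q : nat) (M : 'M[K]_(p, q)) :
    'M[K[i]]_(p, q) :=
  map_mx (real_complex K) M.

(* The system is time-invariant, so every solution of x' = S x on an interval
   is the restriction of one on the whole time axis, which is the domain used
   here. *)
Definition ode_solution (K : realType) (k : nat) (S : 'M[K]_k)
    (x : K -> 'cV[K]_k) : Prop :=
  forall t : K, is_derive t 1 x (S *m x t).

(* Finite multisets of complex numbers are lists up to [perm_eq]. *)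
Definition conj_closed (K : realType) (L : seq K[i]) : Prop :=
  perm_eq (map conjc L) L.

(* The eigenvalues of M over the complex numbers, counted with algebraic
   multiplicity (their order as roots of the characteristic polynomial), are
   exactly L. *)
Definition has_spectrum (K : realType) (k : nat) (M : 'M[K]_k)
    (L : seq K[i]) : Prop :=
  forall z : K[i], mup z (char_poly (complex_mx M)) = count_mem z L.

(* The control law u = - Z G x can drive G x to 0 at an arbitrary rate by
   placing k poles of a subsystem of order k, where k is the number of rows
   of G. *)
Definition drives_at_arbitrary_rate (K : realType) (n m k : nat)
    (A : 'M[K]_n) (B : 'M[K]_(n, m)) (G : 'M[K]_(k, n)) : Prop :=
  forall L : seq K[i],
    size L = k ->
    (forall z, z \in L -> complex.Re z < 0) ->
    conj_closed L ->
    exists (Z : 'M[K]_(m, k)) (M : 'M[K]_k),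
      (forall x : K -> 'cV[K]_n,
         ode_solution (A - B *m Z *m G) x ->
         ode_solution M (fun t => G *m x t)) /\
      has_spectrum M L.

(* Main.v *)
(* Both conditions express that G A = N G for some matrix N and that the pair
   (N, G B) satisfies the Hautus test.

   Necessity: a solution of the closed loop starts from every state, so
   intertwining solutions means G (A - B Z G) = M G, whence N = M + G B Z.  A
   left eigenvector of N annihilating G B keeps its eigenvalue in M for every
   choice of Z, which is impossible for two disjoint spectra.

   Sufficiency is the multi-input pole placement theorem for (N, G B), proved
   on the transposed pair (A, C) = (N^T, (G B)^T) acting on row vectors: by
   Heymann's lemma some A + W C has a cyclic vector b in the row space of C, and
   for a cyclic vector the poles are assigned by comparing Horner schemes. *)
Require Import Defs.
From HB Require Import structures.
From mathcomp Require Import all_boot all_order all_algebra.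
From mathcomp Require Import all_classical all_reals all_analysis.
From mathcomp Require Import complex.

Set Implicit Arguments.
Unset Strict Implicit.
Unset Printing Implicit Defensive.

Import Order.TTheory GRing.Theory Num.Theory.
Import numFieldNormedType.Exports.

Local Open Scope ring_scope.

(** * Krylov spaces and Heymann's lemma *)

Definition krylov (F : fieldType) (k : nat) (b : 'rV[F]_k.+1) (M : 'M[F]_k.+1)
    (j : nat) : 'M[F]_(j, k.+1) :=
  \matrix_(i < j) (b *m M ^+ i).

Lemma krylovP (F : fieldType) (k j p : nat) (b : 'rV[F]_k.+1) (M : 'M[F]_k.+1)
    (U : 'M[F]_(p, k.+1)) :
  (forall i, (i < j)%N -> (b *m M ^+ i <= U)%MS) <-> (krylov b M j <= U)%MS.
Proof.
split=> [bMU | /row_subP bMU i lt_ij].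
  by apply/row_subP => i; rewrite rowK; exact: bMU.
by have := bMU (Ordinal lt_ij); rewrite rowK.
Qed.

Lemma krylov_stable (F : fieldType) (k j : nat) (b : 'rV[F]_k.+1)
    (M : 'M[F]_k.+1) :
  (b *m M ^+ j <= krylov b M j)%MS -> stablemx (krylov b M j) M.
Proof.
move=> bMj; apply/row_subP => i; rewrite row_mul rowK -mulmxA -[_ *m M]exprSr.
have [lt_ij | ge_ij] := ltnP i.+1 j; first exact: (krylovP _ _ _ _).2 _ _ lt_ij.
by have -> : i.+1 = j by apply/eqP; rewrite eqn_leq ge_ij ltn_ord.
Qed.

Lemma krylov_rankS (F : fieldType) (k j : nat) (b : 'rV[F]_k.+1)
    (M : 'M[F]_k.+1) :
  \rank (krylov b M j) = j -> ~~ (b *m M ^+ j <= krylov b M j)%MS ->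
  \rank (krylov b M j.+1) = j.+1.
Proof.
move=> rkj bMj; apply/eqP; rewrite eqn_leq rank_leq_row /= -[X in (X < _)%N]rkj.
have sK : (krylov b M j <= krylov b M j.+1)%MS.
  by apply/krylovP => i lt_ij; apply: (krylovP _ _ _ _).2 => //; exact: ltnW.
by apply: rank_ltmx; rewrite /ltmx sK; apply: contra bMj => /krylovP; apply.
Qed.

(* A Krylov space that is stable but not full misses some row of C; changing
   the feedback on the last Krylov vector only, so that this row is added to its
   image, keeps the vectors already built and makes the next one independent. *)
Lemma heymann (F : fieldType) (k m : nat) (A : 'M[F]_k.+1)
    (C : 'M[F]_(m, k.+1)) (b : 'rV[F]_k.+1) :
  (forall p (U : 'M[F]_(p, k.+1)), stablemx U A -> (C <= U)%MS -> row_full U) ->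
  b != 0 ->
  exists W : 'M[F]_(k.+1, m), row_full (krylov b (A + W *m C) k.+1).
Proof.
move=> obsAC nz_b.
suff /(_ k (leqnn k)) [W rkW] : forall j, (j <= k)%N ->
    exists W : 'M[F]_(k.+1, m), \rank (krylov b (A + W *m C) j.+1) = j.+1.
  by exists W; rewrite /row_full rkW.
elim=> [_|j IHj lt_jk].
  have K0 M : krylov b M 0 = 0 by exact: flatmx0.
  exists 0; apply: krylov_rankS; first by rewrite K0 mxrank0.
  by apply: contra nz_b; rewrite expr0 mulmx1 K0 => /submx0null ->.
have [W rkW] := IHj (ltnW lt_jk); set M := A + W *m C in rkW.
have [bMj | /(krylov_rankS rkW) ?] := boolP (b *m M ^+ j.+1 <= krylov b M j.+1)%MS;
  last by exists W.
set U := krylov b M j.+1 in rkW bMj.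
(* Otherwise [U] would be stable under [A = M - W *m C], hence full, but its rank [j.+1] is at most
   [k]. *)
have nCU : ~~ (C <= U)%MS.
  apply/negP => CU; have /eqP : row_full U.
    apply: (obsAC _ _ _ CU); rewrite -[A](addrK (W *m C)) stablemxD //.
      exact: krylov_stable.
    by rewrite stablemxN mulmxA (submx_trans (submxMl _ _) CU).
  by rewrite rkW => [[jk]]; rewrite jk ltnn in lt_jk.
have /row_subPn [e nCeU] := nCU.
(* The rows of [U] are independent, so [pinvmx U] is a right inverse; [W'] kills every row of [U]
   but the last, which it sends to the [e]-th unit row. *)
pose W' := pinvmx U *m delta_mx ord_max e.
have UW' : U *m W' = delta_mx ord_max e.
  by rewrite mulmxA mulmxVp ?mul1mx // /row_free rkW.
have bMW' i (lt_ij : (i < j.+1)%N) :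
    b *m M ^+ i *m W' = delta_mx 0 (Ordinal lt_ij) *m delta_mx ord_max e.
  have -> : b *m M ^+ i = row (Ordinal lt_ij) U by rewrite rowK.
  by rewrite -row_mul UW' rowE.
have powE i : (i < j.+1)%N -> b *m (M + W' *m C) ^+ i = b *m M ^+ i.
  elim: i => // i IHi lt_ij.
  rewrite !exprSr !mulmxA IHi ?(ltnW lt_ij) // mulmxDr mulmxA (bMW' _ (ltnW lt_ij)).
  rewrite mul_delta_mx_0 ?mul0mx ?addr0 //.
  by rewrite -val_eqE /= neq_ltn -ltnS lt_ij.
have M'E : A + (W + W') *m C = M + W' *m C by rewrite mulmxDl addrA.
have UE : krylov b (M + W' *m C) j.+1 = U.
  by apply/row_matrixP => i; rewrite !rowK powE.
exists (W + W'); rewrite M'E; apply: krylov_rankS; rewrite UE //.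
have bM'E : b *m (M + W' *m C) ^+ j.+1 = b *m M ^+ j.+1 + row e C.
  rewrite !exprSr !mulmxA powE // mulmxDr mulmxA (bMW' _ (ltnSn j)).
  by rewrite (_ : Ordinal _ = ord_max) ?mul_delta_mx ?rowE //; exact: val_inj.
apply: contra nCeU => bM'U.
by rewrite -[row e C](addKr (b *m M ^+ j.+1)) -bM'E addmx_sub // eqmx_opp.
Qed.

(** * Pole placement from a cyclic vector *)

Lemma horner_mx_krylov (F : fieldType) (k j : nat) (b : 'rV[F]_k.+1)
    (M : 'M[F]_k.+1) (p : {poly F}) : (size p <= j)%N ->
  b *m horner_mx M p = poly_rV p *m krylov b M j.
Proof.
move=> le_pj; rewrite -[p in LHS](poly_rV_K le_pj) [rVpoly _]poly_def.
rewrite rmorph_sum mulmx_sumr mulmx_sum_row; apply: eq_bigr => i _ /=.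
by rewrite valK rowK linearZ /= rmorphXn /= horner_mx_X -scalemxAr.
Qed.

(** Both monic polynomials annihilate [b], [char_poly M] by Cayley-Hamilton. Their difference has
    degree at most [k], so its coefficients form a linear relation between independent Krylov
    rows. *)
Lemma cyclic_char_poly (F : fieldType) (k : nat) (b : 'rV[F]_k.+1)
    (M : 'M[F]_k.+1) (p : {poly F}) :
  row_full (krylov b M k.+1) -> p \is monic -> size p = k.+2 ->
  b *m horner_mx M p = 0 -> char_poly M = p.
Proof.
move=> fullK mon_p sz_p bp0.
have freeK : row_free (krylov b M k.+1) by rewrite row_free_unit -row_full_unit.
have le_d : (size (char_poly M - p)%R <= k.+1)%N.
  have lt_d : (size (char_poly M - p)%R <= k.+2)%N.
    by rewrite (leq_trans (size_polyD _ _)) // size_polyN size_char_poly sz_p maxnn.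
  apply/leq_sizeP => i; rewrite leq_eqVlt => /orP[/eqP <- | lt_ki].
    rewrite coefB; have := char_poly_monic M; rewrite monicE lead_coefE.
    rewrite size_char_poly /= => /eqP ->; move: mon_p.
    by rewrite monicE lead_coefE sz_p /= => /eqP ->; rewrite subrr.
  by move/leq_sizeP: lt_d; apply.
have := horner_mx_krylov b M le_d.
rewrite rmorphB mulmxBr bp0 /= Cayley_Hamilton mulmx0 subr0 => /esym/eqP.
rewrite mulmx_free_eq0 // => /eqP d0; apply/eqP; rewrite -subr_eq0.
by rewrite -(poly_rV_K le_d) d0 linear0.
Qed.

(** The partial results of the Horner scheme for [b *m horner_mx M p], running from the leading
    coefficient down to the full value at index 0. *)
Definition horner_tail (F : fieldType) (k : nat) (b : 'rV[F]_k.+1)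
    (M : 'M[F]_k.+1) (p : {poly F}) (i : nat) : 'rV[F]_k.+1 :=
  b *m horner_mx M (drop_poly i p).

Lemma horner_tailS (F : fieldType) (k i : nat) (b : 'rV[F]_k.+1)
    (M : 'M[F]_k.+1) (p : {poly F}) :
  horner_tail b M p i = horner_tail b M p i.+1 *m M + p`_i *: b.
Proof.
rewrite /horner_tail; have -> : drop_poly i p = drop_poly i.+1 p * 'X + (p`_i)%:P.
  apply/polyP=> -[|j]; rewrite coefD coefMX coefC !coef_drop_poly ?add0r //=.
  by rewrite addr0 addSnnS.
rewrite rmorphD rmorphM /= horner_mx_X horner_mx_C mulmxDr mulmxA.
by rewrite mul_mx_scalar.
Qed.

Lemma horner_tail_lead (F : fieldType) (k : nat) (b : 'rV[F]_k.+1)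
    (M : 'M[F]_k.+1) (p : {poly F}) :
  p \is monic -> size p = k.+2 -> horner_tail b M p k.+1 = b.
Proof.
rewrite monicE lead_coefE => lp sz_p; rewrite /horner_tail.
rewrite [drop_poly _ _]size1_polyC ?size_drop_poly ?sz_p ?subSnn //.
rewrite coef_drop_poly horner_mx_C mul_mx_scalar.
by move: lp; rewrite sz_p => /eqP ->; rewrite scale1r.
Qed.

(** The vector [f] makes the Horner scheme of [p] at [M + f *m b] pass through the same vectors as
    that of [q] at [M]. The latter ends in 0, so [p] annihilates [b] under the new matrix. *)
Lemma cyclic_pole_placement (F : fieldType) (k : nat) (b : 'rV[F]_k.+1)
    (M : 'M[F]_k.+1) (p : {poly F}) :
  row_full (krylov b M k.+1) -> p \is monic -> size p = k.+2 ->
  exists f : 'cV[F]_k.+1, char_poly (M + f *m b) = p.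
Proof.
move=> fullK mon_p sz_p; set q := char_poly M.
have mon_q : q \is monic := char_poly_monic M.
have sz_q : size q = k.+2 := size_char_poly M.
pose Y : 'M[F]_k.+1 := \matrix_(i < k.+1) horner_tail b M q i.+1.
have tailY i : (i < k.+1)%N -> (horner_tail b M q i.+1 <= Y)%MS.
  by move=> lt_ik; have := row_sub (Ordinal lt_ik) Y; rewrite rowK.
have bY : (b <= Y)%MS by rewrite -{1}(horner_tail_lead b M mon_q sz_q) tailY.
have tail0 : horner_tail b M q 0 = 0.
  by rewrite /horner_tail drop_poly0l Cayley_Hamilton mulmx0.
have YM : stablemx Y M.
  apply/row_subP => i; rewrite row_mul rowK.
  have -> : horner_tail b M q i.+1 *m M = horner_tail b M q i - q`_i *: b.
    by rewrite [horner_tail b M q i]horner_tailS addrK.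
  rewrite addmx_sub ?eqmx_opp ?scalemx_sub //.
  case: i => [[|i] lt_ik] /=; first by rewrite tail0 sub0mx.
  exact/tailY/ltnW.
(* The row space of [Y] contains [b] and is stable under [M], so it contains the whole Krylov
   space. *)
have unitY : Y \in unitmx.
  rewrite -row_full_unit -sub1mx (submx_trans (submx_full 1%:M fullK)) //.
  apply/krylovP => i _; elim: i => [|i IHi]; first by rewrite expr0 mulmx1.
  by rewrite exprSr mulmxA (submx_trans (submxMr _ IHi)).
(* In the [i]-th Horner step, [f *m b] then contributes the multiple of [b] that turns the
   coefficient of [p] into that of [q]. *)
pose f := invmx Y *m \col_(i < k.+1) (q`_i - p`_i).
have tailf (i : 'I_k.+1) : horner_tail b M q i.+1 *m f = (q`_i - p`_i)%:M.
  have -> : horner_tail b M q i.+1 = row i Y by rewrite rowK.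
  rewrite -row_mul mulKVmx //; apply/rowP => j; rewrite !mxE.
  by rewrite !ord1 mulr1n.
exists f; set M' := M + f *m b.
have tailE i : (i <= k.+1)%N -> horner_tail b M' p i = horner_tail b M q i.
  (* Downward induction on [i] from [k.+1], where both tails are [b]. *)
  move=> le_ik; rewrite -(subKn le_ik); move: (k.+1 - i)%N (leq_subr i k.+1).
  elim=> [_|l IHl lt_lk]; first by rewrite subn0 !horner_tail_lead.
  set j := (k.+1 - l.+1)%N.
  have jS : j.+1 = (k.+1 - l)%N by rewrite -subSn.
  have lt_jk : (j < k.+1)%N by rewrite jS leq_subr.
  rewrite horner_tailS [RHS]horner_tailS jS IHl ?(ltnW lt_lk) // -jS.
  rewrite mulmxDr mulmxA (tailf (Ordinal lt_jk)) mul_scalar_mx -addrA -scalerDl.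
  by rewrite subrK.
(* The rows of [Y] span everything and are Horner tails of [p] at [M'], so [b] stays cyclic for
   [M']. *)
have fullK' : row_full (krylov b M' k.+1).
  have /row_fullP [Y' Y'Y] : row_full Y by rewrite row_full_unit.
  rewrite -sub1mx -Y'Y (submx_trans (submxMl _ _)) //.
  apply/row_subP => i; rewrite rowK -tailE // /horner_tail.
  rewrite (@horner_mx_krylov _ _ k.+1) ?submxMl //.
  by rewrite size_drop_poly sz_p leq_subLR addSn ltnS leq_addl.
apply: cyclic_char_poly fullK' mon_p sz_p _.
by have := tailE 0 (leq0n _); rewrite tail0 /horner_tail drop_poly0l.
Qed.

(** Heymann's lemma reduces this to a cyclic vector [b = D *m C]; the correction [f *m b] is again
    feedback through [C]. *)
Theorem observable_pole_placement (F : fieldType) (k m : nat) (A : 'M[F]_k)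
    (C : 'M[F]_(m, k)) (p : {poly F}) :
  (forall q (U : 'M[F]_(q, k)), stablemx U A -> (C <= U)%MS -> row_full U) ->
  p \is monic -> size p = k.+1 ->
  exists W : 'M[F]_(k, m), char_poly (A + W *m C) = p.
Proof.
case: k A C => [|k] A C obsAC mon_p sz_p.
  exists 0; rewrite /char_poly det_mx00 [p]size1_polyC ?sz_p //.
  by move: mon_p; rewrite monicE lead_coefE sz_p /= => /eqP ->.
(* For [C = 0] the zero subspace would be stable and contain the rows of [C], hence be full. *)
have [C0 | /rowV0Pn [b Cb nz_b]] := eqVneq C 0.
  have := obsAC 1%N 0; rewrite C0 sub0mx mul0mx sub0mx.
  by rewrite /row_full mxrank0 => /(_ isT isT).
have [W fullW] := heymann obsAC nz_b.
have [f <-] := cyclic_pole_placement fullW mon_p sz_p.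
have [D ->] := submxP Cb; exists (W + f *m D).
by rewrite mulmxDl addrA mulmxA.
Qed.

(** * Derivatives of matrix functions and solutions of linear equations *)

Lemma is_derive_mxP (R : realFieldType) (V : normedModType R) (p q : nat)
    (M : V -> 'M[R]_(p, q)) (t v : V) (dM : 'M[R]_(p, q)) :
  is_derive t v M dM <->
  forall i j, is_derive t v (fun x => M x i j) (dM i j).
Proof.
split=> [[M' <-] i j | M'].
  by split; [exact: (derivable_mxP _ _ _).1 | rewrite derive_mx // mxE].
have dM' : derivable M t v by apply/derivable_mxP => i j; case: (M' i j).
split=> //; rewrite derive_mx //; apply/matrixP => i j.
by rewrite mxE; case: (M' i j).
Qed.

Lemma is_derive_mulmx (R : realFieldType) (V : normedModType R) (p q s : nat)
    (G : 'M[R]_(p, q)) (M : V -> 'M[R]_(q, s)) (t v : V) (dM : 'M[R]_(q, s)) :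
  is_derive t v M dM -> is_derive t v (fun x => G *m M x) (G *m dM).
Proof.
move=> /is_derive_mxP M'; apply/is_derive_mxP => i j.
rewrite mxE (_ : (fun _ => _) = \sum_(l < q) (G i l \*: (fun x => M x l j))).
  exact: is_derive_sum.
by apply/funext => x; rewrite mxE fct_sumE.
Qed.

Section LinearOde.
Variables (K : realType) (n : nat) (S : 'M[K]_n).

(** Taylor coefficients of the [i]-th entry of exp(tS)v; working by entries allows the use of scalar
    power series. *)
Definition expmx_coeff (v : 'cV[K]_n) (i : 'I_n) (l : nat) : K :=
  iter l (mulmx S) v i 0 / l`!%:R.

(** Any geometric bound will do: with the factorial in [expmx_coeff] it gives an exponential series
    as majorant. *)
Lemma iter_mulmx_bound (v : 'cV[K]_n) (l : nat) (i : 'I_n) :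
  `|iter l (mulmx S) v i 0| <=
  (\sum_i `|v i 0|) * (\sum_i \sum_j `|S i j|) ^+ l.
Proof.
elim: l i => [|l IHl] i.
  by rewrite expr0 mulr1 /= (bigD1 i) //= lerDl sumr_ge0.
rewrite iterS mxE exprSr mulrA (le_trans (ler_norm_sum _ _ _)) //.
apply: (@le_trans _ _ (\sum_j `|S i j| *
    ((\sum_i `|v i 0|) * (\sum_i \sum_j `|S i j|) ^+ l))).
  by apply: ler_sum => j _; rewrite normrM ler_wpM2l.
rewrite -mulr_suml mulrC ler_wpM2l //.
  by rewrite mulr_ge0 ?exprn_ge0 ?sumr_ge0 // => ? _; rewrite sumr_ge0.
by rewrite [leRHS](bigD1 i) //= lerDl sumr_ge0 // => ? _; rewrite sumr_ge0.
Qed.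

Lemma is_cvg_expmx_coeff (v : 'cV[K]_n) (i : 'I_n) (t : K) :
  cvgn (pseries (expmx_coeff v i) t).
Proof.
apply: normed_cvg.
pose D : K := \sum_i `|v i 0|; pose C : K := \sum_i \sum_j `|S i j|.
have C0 : 0 <= C by apply: sumr_ge0 => ? _; apply: sumr_ge0.
have D0 : 0 <= D by apply: sumr_ge0.
apply: (@series_le_cvg _ _ (fun l => D * exp_coeff (C * `|t|) l)) => [l|l|l|].
- exact: normr_ge0.
- by rewrite mulr_ge0 // exp_coeff_ge0 // mulr_ge0.
- rewrite /= /expmx_coeff !normrM normrX [`|_^-1|]ger0_norm ?invr_ge0 //.
  rewrite /exp_coeff /= exprMn !mulrA [X in X <= _]mulrAC.
  by rewrite !ler_wpM2r ?invr_ge0 ?exprn_ge0 // iter_mulmx_bound.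
- exact: (@is_cvg_seriesZ _ _ D (is_cvg_series_exp_coeff _)).
Qed.

Definition expmx_orbit (v : 'cV[K]_n) (t : K) : 'cV[K]_n :=
  \col_i limn (pseries (expmx_coeff v i) t).

(** The factor [l.+1] from termwise differentiation cancels in the factorial, leaving one more
    application of [S]. *)
Lemma pseries_diffs_expmx_coeff (v : 'cV[K]_n) (i : 'I_n) :
  pseries_diffs (expmx_coeff v i) = expmx_coeff (S *m v) i.
Proof.
apply/funext => l; rewrite /pseries_diffs /expmx_coeff iterSr factS natrM.
by rewrite invfM mulrCA mulVKf // pnatr_eq0.
Qed.

Lemma expmx_orbit_mulmx (v : 'cV[K]_n) (t : K) :
  expmx_orbit (S *m v) t = S *m expmx_orbit v t.
Proof.
apply/colP => i; rewrite !mxE.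
have -> : pseries (expmx_coeff (S *m v) i) t =
    \sum_j (S i j \*: pseries (expmx_coeff v j) t).
  apply/funext => N; rewrite /pseries /series fct_sumE /=.
  under [RHS]eq_bigr do rewrite /GRing.scale /= mulr_sumr.
  rewrite exchange_big; apply: eq_bigr => l _ /=.
  rewrite /expmx_coeff -iterSr iterS mxE !mulr_suml; apply: eq_bigr => j _.
  by rewrite !mulrA.
under [RHS]eq_bigr do rewrite mxE.
apply: cvg_lim => //.
rewrite (_ : (\sum_j _ : nat -> K) =
  fun N => \sum_j S i j * pseries (expmx_coeff v j) t N); last first.
  by apply/funext => N; rewrite fct_sumE.
apply: cvg_big => [|j _]; first exact: add_continuous.
by apply: cvgMr; apply: is_cvg_expmx_coeff.
Qed.

Lemma ode_solution_expmx_orbit (v : 'cV[K]_n) : ode_solution S (expmx_orbit v).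
Proof.
move=> t; rewrite -expmx_orbit_mulmx; apply/is_derive_mxP => i j.
rewrite mxE (_ : (fun _ => _) = fun x => limn (pseries (expmx_coeff v i) x)).
  rewrite -pseries_diffs_expmx_coeff.
  apply: (@pseries_snd_diffs _ _ (`|t| + 1));
    rewrite ?pseries_diffs_expmx_coeff; try exact: is_cvg_expmx_coeff.
  by rewrite [ltRHS]ger0_norm ?addr_ge0 // ltrDl.
by apply/funext => x; rewrite mxE.
Qed.

Lemma expmx_orbit0 (v : 'cV[K]_n) : expmx_orbit v 0 = v.
Proof.
apply/colP => i; rewrite mxE; apply: lim_near_cst => //.
near=> N; rewrite -[N]prednK; last by near: N.
rewrite /pseries /series /= big_nat_recl //= big1.
  by rewrite /expmx_coeff /= fact0 divr1 expr0 mulr1 addr0.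
by move=> l _; rewrite expr0n mulr0.
Unshelve. all: by end_near. Qed.

End LinearOde.

(** * The Hautus test and real characteristic polynomials *)

(** The matrix [g] represents [N] restricted to [V] in the basis [row_base V]; an eigenvector of [g]
    lifts to one of [N]. *)
Lemma stable_eigenvector (C : numClosedFieldType) (k p : nat) (V : 'M[C]_(p, k))
    (N : 'M[C]_k) :
  stablemx V N -> V != 0 ->
  exists2 v : 'rV[C]_k, v != 0 /\ (v <= V)%MS & exists a, v *m N = a *: v.
Proof.
move=> VN nzV; pose E := row_base V; pose g := E *m N *m pinvmx E.
have gE : g *m E = E *m N.
  by apply: mulmxKpV; rewrite eq_row_base (submx_trans _ VN) // submxMr ?eq_row_base.
have [|a /eigenvalueP [v vg nzv]] := eigenvalue_closed g.
  by rewrite lt0n mxrank_eq0.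
exists (v *m E).
  rewrite mulmx_free_eq0 ?row_base_free //; split=> //.
  by rewrite mulmx_sub // eq_row_base.
by exists a; rewrite -mulmxA -gE mulmxA vg scalemxAl.
Qed.

(** If [U] were not full, the left kernel of its transpose over [C] would be nonzero, stable under
    [N], and would annihilate [D]; an eigenvector in it contradicts the test. *)
Lemma hautus_observable (F : fieldType) (C : numClosedFieldType)
    (f : {rmorphism F -> C}) (k m : nat) (N : 'M[F]_k) (D : 'M[F]_(k, m)) :
  (forall (a : C) (v : 'rV[C]_k),
     v *m map_mx f N = a *: v -> v *m map_mx f D = 0 -> v = 0) ->
  forall p (U : 'M[F]_(p, k)),
    stablemx U N^T -> (D^T <= U)%MS -> row_full U.
Proof.
move=> hautus p U /submxP [E UE] /submxP [E' DE].
have NU : N *m U^T = U^T *m E^T by rewrite -trmx_mul -UE trmx_mul trmxK.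
have {}DE : D = U^T *m E'^T by rewrite -trmx_mul -DE trmxK.
rewrite -(row_full_map f) -[map_mx f U]trmxK map_trmx.
set V := map_mx f U^T; rewrite /row_full mxrank_tr -/(row_free V) -kermx_eq0.
apply/eqP/eqP; apply: contraT => nzK.
have [|v [nzv vK] [a va]] := stable_eigenvector _ nzK (N := map_mx f N).
  by apply/sub_kermxP; rewrite -mulmxA -map_mxM NU map_mxM mulmxA mulmx_ker mul0mx.
move/sub_kermxP: vK => vV.
by case/eqP: nzv; apply: hautus va _; rewrite DE map_mxM mulmxA vV mul0mx.
Qed.

(** Conjugation permutes the linear factors, so it fixes the coefficients of the product. *)
Lemma conj_closed_real_poly (K : realType) (L : seq K[i]) :
  conj_closed L ->
  exists p : {poly K}, map_poly (real_complex K) p = \prod_(z <- L) ('X - z%:P).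
Proof.
move=> conjL; set P := \prod_(z <- L) _.
have conjP : map_poly (@conjc K) P = P.
  rewrite -[RHS](perm_big _ conjL) big_map rmorph_prod.
  by apply: eq_bigr => z _; rewrite /= map_polyXsubC.
exists (\poly_(i < size P) complex.Re P`_i); apply/polyP => i.
rewrite coef_map coef_poly /=; case: ltnP => [_ | /(nth_default 0) -> //].
have : conjc P`_i = P`_i by rewrite -{2}conjP coef_map.
case: (P`_i) => x y [] /eqP; rewrite eq_sym -subr_eq0 opprK -mulr2n mulrn_eq0 /=.
by move=> /eqP ->.
Qed.

Lemma char_poly_trmx (R : comNzRingType) (k : nat) (M : 'M[R]_k) :
  char_poly M^T = char_poly M.
Proof.
rewrite /char_poly -[RHS]det_tr; congr (\det _).
by apply/matrixP => i j; rewrite !mxE eq_sym.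
Qed.

Lemma has_spectrum_root (K : realType) (k : nat) (M : 'M[K]_k) (L : seq K[i])
    (a : K[i]) (v : 'rV[K[i]]_k) :
  has_spectrum M L -> v *m complex_mx M = a *: v -> v != 0 -> a \in L.
Proof.
move=> specM va nzv; rewrite -has_pred1 has_count -specM.
rewrite -XsubC_dvd ?monic_neq0 ?char_poly_monic // dvdp_XsubCl.
by rewrite -eigenvalue_root_char; apply/eigenvalueP; exists v.
Qed.

Lemma is_derive_unique (K : realFieldType) (W : normedModType K) (f : K -> W)
    (t : K) (df df' : W) : is_derive t 1 f df -> is_derive t 1 f df' -> df = df'.
Proof. by move=> [_ <-] [_ <-]. Qed.

(** * The closed loop and the rank conditions *)

Lemma feedback_intertwines (K : realType) (n k : nat) (S : 'M[K]_n)
    (G : 'M[K]_(k, n)) (M : 'M[K]_k) :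
  (forall x, ode_solution S x -> ode_solution M (fun t => G *m x t)) <->
  G *m S = M *m G.
Proof.
split=> [GSM | GS x Sx t]; last first.
  by rewrite mulmxA -GS -mulmxA; apply: is_derive_mulmx.
apply: trmx_inj; apply/row_matrixP => j; rewrite -!tr_col !colE; congr (_^T).
(* Comparing derivatives at time 0 along the solution starting at the [j]-th basis vector gives
   column [j] of the identity. *)
have Sx := ode_solution_expmx_orbit S (delta_mx j 0).
have := is_derive_unique (is_derive_mulmx G (Sx 0)) (GSM _ Sx 0).
by rewrite expmx_orbit0 !mulmxA.
Qed.

Lemma drives_at_arbitrary_rateP (K : realType) (n m k : nat) (A : 'M[K]_n)
    (B : 'M[K]_(n, m)) (G : 'M[K]_(k, n)) :
  (0 < k)%N -> row_free G ->
  drives_at_arbitrary_rate A B G <->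
  (G *m A <= G)%MS /\
  forall s : K[i], row_free (row_mx (s *: complex_mx G - complex_mx (G *m A))
                                    (complex_mx (G *m B))).
Proof.
move=> k_gt0 freeG; split=> [drives | [/submxP [N GA] hautus] L sz_L _ conjL].
  (* The test spectra consist of one negative real [c] repeated [k] times. *)
  have place c : c < 0 -> exists Z : 'M[K]_(m, k), exists M : 'M[K]_k,
      G *m A = (M + G *m B *m Z) *m G /\ has_spectrum M (nseq k c%:C%C).
    move=> c_lt0; have [|||Z [M [GSM specM]]] := drives (nseq k c%:C%C).
    - by rewrite size_nseq.
    - by move=> z /nseqP [-> _].
    - by rewrite /conj_closed map_nseq conjc_real.
    exists Z, M; split=> //; move/feedback_intertwines: GSM.
    by rewrite mulmxBr !mulmxA mulmxDl => <-; rewrite subrK.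
  split=> [|s].
    by have [|Z [M [-> _]]] := place (-1); rewrite ?oppr_lt0 ?submxMl.
  rewrite -kermx_eq0; apply: contraT => /rowV0Pn [v /sub_kermxP].
  rewrite mul_mx_row => /eqP; rewrite row_mx_eq0 => /andP[/eqP vG /eqP vB] nzv.
  (* Since [v] kills [G *m B], the feedback term drops out and [v] is a left eigenvector of [M] for
     [s]. Hence [s = c] for every negative [c], which is absurd for -1 and -2. *)
  have sE c : c < 0 -> s = c%:C%C.
    move=> c_lt0; have [Z [M [GA specM]]] := place c c_lt0.
    suff /(has_spectrum_root specM)/(_ nzv)/nseqP[] :
      v *m complex_mx M = s *: v by [].
    have freeG' : row_free (complex_mx G) by rewrite row_free_map.
    apply: (row_free_inj freeG'); rewrite /= -scalemxAl.
    apply/esym/eqP; rewrite -subr_eq0 -[eqbRHS]vG mulmxBr -scalemxAr GA.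
    rewrite mulmxDl -[G *m B *m Z *m G]mulmxA /complex_mx map_mxD !map_mxM.
    rewrite mulmxDr !mulmxA -[v *m _ *m map_mx _ B]mulmxA -map_mxM vB.
    by rewrite !mul0mx addr0.
  have /complexI/eqP : (-1 : K)%:C%C = (-2)%:C%C by rewrite -!sE ?oppr_lt0.
  by rewrite eqr_opp (eqr_nat K 1 2).
(* A left eigenvector of [N] for [a] annihilating [G *m B] lies in the left kernel of the block row
   at [s = a]. *)
have obsN : forall p (U : 'M[K]_(p, k)),
    stablemx U N^T -> ((G *m B)^T <= U)%MS -> row_full U.
  apply: (@hautus_observable _ _ (real_complex K)) => a v va vD.
  apply/eqP; rewrite -(mulmx_free_eq0 _ (hautus a)) mul_mx_row vD.
  rewrite mulmxBr GA /complex_mx map_mxM mulmxA va -scalemxAl -scalemxAr subrr.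
  by rewrite row_mx0.
have [p pL] := conj_closed_real_poly conjL.
have mon_p : p \is monic.
  by rewrite -(map_monic (real_complex K)) pL monic_prod_XsubC.
have sz_p : size p = k.+1.
  by rewrite -(size_map_poly (real_complex K)) pL size_prod_XsubC sz_L.
have [W charW] := observable_pole_placement obsN mon_p sz_p.
(* Here [M] is the transpose of [N^T + W *m (G *m B)^T]; the sign of [Z] comes from the law
   [u = - Z G x]. *)
exists (- W^T), (N + G *m B *m W^T); split.
  apply/feedback_intertwines.
  by rewrite mulmxN mulNmx opprK mulmxDr !mulmxA mulmxDl GA.
move=> z; rewrite -mu_prod_XsubC -pL -charW /complex_mx -map_char_poly.
congr (mup z (map_poly _ _)); rewrite -[in RHS]char_poly_trmx.
by rewrite [in RHS]linearD /= trmx_mul !trmxK.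
Qed.

Theorem corollary4 (K : realType) (n m r n0 : nat)
    (A : 'M[K]_n) (B : 'M[K]_(n, m))
    (F : 'M[K]_(r, n)) (R : 'M[K]_(n0 - r, n))
    (hr : (r < n0)%N) (hn0 : (n0 <= n)%N)
    (hrank : \rank (col_mx F R) = n0) :
  drives_at_arbitrary_rate A B (col_mx F R) <->
  (\rank (col_mx (col_mx (F *m A) (R *m A)) (col_mx F R)) =
     \rank (col_mx F R) /\
   forall s : K[i],
     \rank (block_mx (s *: complex_mx F - complex_mx (F *m A))
                     (complex_mx (F *m B))
                     (s *: complex_mx R - complex_mx (R *m A))
                     (complex_mx (R *m B))) =
     \rank (col_mx F R)).
Proof.
have freeG : row_free (col_mx F R) by rewrite /row_free hrank subnKC // ltnW.
have k_gt0 : (0 < r + (n0 - r))%N by rewrite subnKC ?(leq_trans _ hr) // ltnW.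
have rank1 : \rank (col_mx (col_mx (F *m A) (R *m A)) (col_mx F R)) =
    \rank (col_mx F R) <-> (col_mx F R *m A <= col_mx F R)%MS.
  rewrite -mul_col_mx -addsmxE.
  (* The row space of the stack contains that of [col_mx F R], so equal ranks amount to the reverse
     inclusion. *)
  have [_ rkE] := mxrank_leqif_sup (addsmxSr (col_mx F R *m A) (col_mx F R)).
  split=> [/esym/eqP | sGA].
    by rewrite rkE; apply: submx_trans; exact: addsmxSl.
  by apply/esym/eqP; rewrite rkE addsmx_sub sGA submx_refl.
have rank2 s : \rank (block_mx (s *: complex_mx F - complex_mx (F *m A))
    (complex_mx (F *m B)) (s *: complex_mx R - complex_mx (R *m A))
    (complex_mx (R *m B))) = \rank (col_mx F R) <->
  row_free (row_mx (s *: complex_mx (col_mx F R) - complex_mx (col_mx F R *m A))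
                   (complex_mx (col_mx F R *m B))).
  rewrite !mul_col_mx /complex_mx !map_col_mx scale_col_mx opp_col_mx add_col_mx.
  rewrite -block_mxEh hrank /row_free; set rk := \rank _.
  rewrite subnKC; last exact: ltnW.
  by split=> [/eqP | /eqP].
split=> [/(drives_at_arbitrary_rateP A B k_gt0 freeG) [/rank1 ? free2] |
         [/rank1 ? rk2]].
  by split=> // s; exact/rank2.
apply/(drives_at_arbitrary_rateP A B k_gt0 freeG).
by split=> // s; exact/rank2.
Qed.
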